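(* Let $\overline\rho,\overline p_\rho,\overline k,\overline\nu,\overline\lambda>0$ be constants and $\overline{u}=(\overline u_1,\overline u_2)^\top\in\mathbb{R}^2$. The linearized two-dimensional Navier--Stokes--Korteweg system for $U=(\rho,u_1,u_2)^\top$, $u=(u_1,u_2)^\top$, $x\in\mathbb{R}^2$, $$\rho_t+\overline u\cdot\nabla\rho+\overline\rho\,\nabla\cdot u=0,$$ $$\overline\rho\,u_t+\overline\rho\,(\overline u\cdot\nabla)u+\overline p_\rho\nabla\rho=\overline\nu\Delta u+(\overline\nu+\overline\lambda)\nabla(\nabla\cdot u)+\overline k\,\overline\rho\,\nabla\Delta\rho,$$ is symbol symmetrizable and genuinely coupled.
   Context: The system is the linearization around a constant state $(\overline\rho,\overline u)$ of the isothermal compressible viscous-capillary fluid equations; overlined quantities are values at that state of the pressure derivative $p_\rho$, capillarity coefficient $k$ and viscosities $\nu$ (shear), $\lambda$ (bulk). After division of the momentum equation by $\overline\rho$ the system has the form $U_t+\sum_{|\alpha|\le m}L^\alpha D^\alpha U=0$ with constant real $n\times n$ matrices. For $\xi\in\mathbb{R}^d\setminus\{0\}$, $\omega=\xi/|\xi|$, put $A(\xi)=\sum_{|\alpha|\text{ odd}}|\xi|^{|\alpha|-1}(-1)^{(|\alpha|-1)/2}\omega^\alpha L^\alpha$ and $B(\xi)=\sum_{|\alpha|\text{ even}}|\xi|^{|\alpha|}(-1)^{|\alpha|/2}\omega^\alpha L^\alpha$ (so $\widehat U_t+i|\xi|A\widehat U+B\widehat U=0$). Symbol symmetrizable: there is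 $S\in C^\infty(\mathbb{R}^d\setminus\{0\};\mathbb{R}^{n\times n})$ with $S(\xi)$ symmetric positive definite, $S(\xi)A(\xi)$ and $S(\xi)B(\xi)$ symmetric and $S(\xi)B(\xi)\ge0$ for all $\xi\neq0$. Genuinely coupled: for every $\xi\ne0$, $(\mu I_n+A(\xi))\psi\ne0$ for every $\mu\in\mathbb{R}$ and every $\psi\in\ker B(\xi)$, $\psi\ne0$. *)

(* Defs.v *)
From HB Require Import structures.
From mathcomp Require Import all_boot all_order all_algebra.
From mathcomp Require Import all_classical all_reals all_analysis.
Set Implicit Arguments.
Unset Strict Implicit.
Unset Printing Implicit Defensive.
Import Order.TTheory GRing.Theory Num.Theory.
Import numFieldNormedType.Exports.
Local Open Scope classical_set_scope.
Local Open Scope ring_scope.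

(* Used only with V finite-dimensional and O open; asking for the derivatives
   along all vectors is then the same as asking for the partial derivatives. *)
Fixpoint Ck_on (R : realType) (V W : normedModType R) (k : nat)
    (O : set V) (f : V -> W) : Prop :=
  (forall x, O x -> {for x, continuous f}) /\
  match k with
  | 0%N => True
  | k'.+1 => forall v, (forall x, O x -> derivable f x v) /\
                       Ck_on k' O ('D_v f)
  end.

Definition smooth_on (R : realType) (V W : normedModType R)
    (O : set V) (f : V -> W) : Prop := forall k, Ck_on k O f.

Definition posdefmx (R : realType) (n : nat) (M : 'M[R]_n) : Prop :=
  M^T = M /\ forall v : 'cV[R]_n, v != 0 -> 0 < (v^T *m M *m v) 0 0.

Definition possemidefmx (R : realType) (n : nat) (M : 'M[R]_n) : Prop :=
  M^T = M /\ forall v : 'cV[R]_n, 0 <= (v^T *m M *m v) 0 0.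

(* The library norm `|xi| on row vectors is the sup norm. *)
Definition enorm (R : realType) (d : nat) (xi : 'rV[R]_d) : R :=
  Num.sqrt (\sum_(j < d) xi 0 j ^+ 2).

(* The multi-indices of order at most m are the alpha : mindex d m
   with (morder alpha <= m)%N. *)
Definition mindex (d m : nat) := {ffun 'I_d -> 'I_m.+1}.

Definition morder (d m : nat) (alpha : mindex d m) : nat :=
  (\sum_(j < d) alpha j)%N.

Definition mindex_is (d m : nat) (alpha : mindex d m) (b : 'I_d -> nat) : bool :=
  [forall j, alpha j == b j :> nat].

Section Symbol.
Context (R : realType) (d n m : nat) (L : mindex d m -> 'M[R]_n).

Definition monom (x : 'rV[R]_d) (alpha : mindex d m) : R :=
  \prod_(j < d) x 0 j ^+ alpha j.

Definition symbA (xi : 'rV[R]_d) : 'M[R]_n :=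
  let omega := (enorm xi)^-1 *: xi in
  \sum_(alpha : mindex d m | (morder alpha <= m)%N && odd (morder alpha))
    (enorm xi ^+ (morder alpha).-1 * (-1) ^+ ((morder alpha).-1)./2
       * monom omega alpha) *: L alpha.

Definition symbB (xi : 'rV[R]_d) : 'M[R]_n :=
  let omega := (enorm xi)^-1 *: xi in
  \sum_(alpha : mindex d m | (morder alpha <= m)%N && ~~ odd (morder alpha))
    (enorm xi ^+ morder alpha * (-1) ^+ (morder alpha)./2
       * monom omega alpha) *: L alpha.

Definition symbol_symmetrizable : Prop :=
  exists S : 'rV[R]_d -> 'M[R]_n,
    smooth_on [set xi | xi != 0] S /\
    forall xi, xi != 0 ->
      [/\ posdefmx (S xi),
          (S xi *m symbA xi)^T = S xi *m symbA xi &
          possemidefmx (S xi *m symbB xi)].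

Definition genuinely_coupled : Prop :=
  forall xi : 'rV[R]_d, xi != 0 ->
  forall (mu : R) (psi : 'cV[R]_n), symbB xi *m psi = 0 -> psi != 0 ->
    (mu%:M + symbA xi) *m psi != 0.

End Symbol.

(* Functions of z = (t, x) with t : R and x : 'rV[R]_d. *)
Section Derivatives.
Context (R : realType) (d : nat) (W : normedModType R).
Implicit Type f : (R * 'rV[R]_d)%type -> W.

Definition dt f : R * 'rV[R]_d -> W := 'D_((1, 0) : R * 'rV[R]_d) f.

Definition dx (j : 'I_d) f : R * 'rV[R]_d -> W :=
  'D_((0, delta_mx 0 j) : R * 'rV[R]_d) f.

Definition dmulti (m : nat) (alpha : mindex d m) f : R * 'rV[R]_d -> W :=
  foldr (fun j g => iter (alpha j) (dx j) g) f (enum 'I_d).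

Definition lapl f : R * 'rV[R]_d -> W := fun z => \sum_(j < d) dx j (dx j f) z.

End Derivatives.

Definition divg (R : realType) (d : nat) (v : 'I_d -> R * 'rV[R]_d -> R) :
  R * 'rV[R]_d -> R := fun z => \sum_(j < d) dx j (v j) z.

(* The equations sys read U_t + sum_alpha L^alpha D^alpha U = 0. Being required
   at each point and for every smooth U, solution or not, this determines
   L alpha for all |alpha| <= m. *)
Definition system_has_form (R : realType) (d n m : nat)
    (sys : (R * 'rV[R]_d -> 'cV[R]_n) -> R * 'rV[R]_d -> Prop)
    (L : mindex d m -> 'M[R]_n) : Prop :=
  forall U : R * 'rV[R]_d -> 'cV[R]_n, smooth_on setT U ->
  forall z, sys U z <->
    dt U z + \sum_(alpha : mindex d m | (morder alpha <= m)%N)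
               L alpha *m dmulti alpha U z = 0.

Section NavierStokesKorteweg.
Context (R : realType) (rhob pb kb nub lamb : R) (ub : 'rV[R]_2).

Definition nsk (U : R * 'rV[R]_2 -> 'cV[R]_3) (z : R * 'rV[R]_2) : Prop :=
  let rho : R * 'rV[R]_2 -> R := fun y => U y 0 0 in
  let u (i : 'I_2) : R * 'rV[R]_2 -> R := fun y => U y (lift 0 i) 0 in
  dt rho z + \sum_(j < 2) ub 0 j * dx j rho z + rhob * divg u z = 0 /\
  forall i : 'I_2,
    rhob * dt (u i) z + rhob * (\sum_(j < 2) ub 0 j * dx j (u i) z)
      + pb * dx i rho z
    = nub * lapl (u i) z + (nub + lamb) * dx i (divg u) z
      + kb * rhob * dx i (lapl rho) z.

(* The terms are those of the momentum equation divided by rhob, moved to the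
   left-hand side; row and column lift 0 i carry the component u_i. *)
Definition nsk_coef (alpha : mindex 2 3) : 'M[R]_3 :=
  \sum_(j < 2) (mindex_is alpha (fun l => l == j))%:R *:
    ((ub 0 j)%:M + rhob *: delta_mx 0 (lift 0 j)
       + (pb / rhob) *: delta_mx (lift 0 j) 0)
  - \sum_(j < 2) (mindex_is alpha (fun l => 2 * (l == j))%N)%:R *:
      ((nub / rhob) *: \sum_(i < 2) delta_mx (lift 0 i) (lift 0 i))
  - \sum_(i < 2) \sum_(j < 2)
      (mindex_is alpha (fun l => (l == i) + (l == j))%N)%:R *:
      (((nub + lamb) / rhob) *: delta_mx (lift 0 i) (lift 0 j))
  - \sum_(i < 2) \sum_(j < 2)
      (mindex_is alpha (fun l => (l == i) + 2 * (l == j))%N)%:R *: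
      (kb *: delta_mx (lift 0 i) 0).

End NavierStokesKorteweg.

(* Main.v *)
Require Import Defs.
From HB Require Import structures.
From mathcomp Require Import all_boot all_order all_algebra.
From mathcomp Require Import all_classical all_reals all_analysis.
From mathcomp Require Import ring.
Set Implicit Arguments.
Unset Strict Implicit.
Unset Printing Implicit Defensive.
Import Order.TTheory GRing.Theory Num.Theory.
Import numFieldNormedType.Exports.
Local Open Scope classical_set_scope.
Local Open Scope ring_scope.

(* The capillarity term k grad Delta rho enters the odd part A of the symbol next
   to the pressure term. With w = xi/|xi|, A = (ub.w) I plus the off-diagonal
   blocks rho w^T and (p/rho + k|xi|^2) w, while B is the viscous block
   |xi|^2 (nu/rho I + (nu+lambda)/rho w w^T) acting on u only. Hence
   S = diag ((p/rho + k|xi|^2)/rho, 1, 1) symmetrizes A, leaves B unchanged, and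
   is polynomial in xi. The kernel of B is the rho-axis, and A sends it to
   vectors with nonzero velocity component (p/rho + k|xi|^2) w, which gives
   genuine coupling. *)

(** * Symmetry of mixed second derivatives *)

(** Both difference quotients are the same function of the increment. This turns a derivative along
    [u] into a one-variable derivative, to which the mean value theorem applies. *)
Lemma is_derive_line (R : realType) (V W : normedModType R) (f : V -> W)
    (a u : V) (s : R) :
  derivable f (a + s *: u) u ->
  is_derive s 1 (fun h : R => f (a + h *: u)) ('D_u f (a + s *: u)).
Proof.
move=> df.
have E : (fun h : R => h^-1 *: (((fun h : R => f (a + h *: u)) \o shift s) (h *: 1) -
      f (a + s *: u))) =
    (fun h => h^-1 *: ((f \o shift (a + s *: u)) (h *: u) - f (a + s *: u))).
  by apply/funext => h /=; rewrite [h *: 1]mulr1 scalerDl addrCA.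
by split; rewrite /derivable /derive E.
Qed.

Lemma normrB_le_half (R : realFieldType) (a b c e : R) :
  `|a - c| < e / 2 -> `|b - c| < e / 2 -> `|a - b| <= e.
Proof.
move=> ac bc; apply: le_trans (ler_distD c _ _) _.
by rewrite (splitr e) lerD // ltW // distrC.
Qed.

(* MVT for h |-> f (x + h u + t v) - f (x + h u), then for h |-> 'D_u f (x + s' u + h v). *)
Lemma second_difference_MVT (R : realType) (V : normedModType R) (f : V -> R)
    (x u v : V) (s t : R) :
  (forall y, derivable f y u) -> (forall y, derivable ('D_u f) y v) ->
  0 < s -> 0 < t ->
  exists s' t', [/\ 0 < s' < s, 0 < t' < t &
    f (x + s *: u + t *: v) - f (x + s *: u) - f (x + t *: v) + f x =
    'D_v ('D_u f) (x + s' *: u + t' *: v) * (s * t)].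
Proof.
move=> du dvu s0 t0.
pose g (h : R) := f (x + t *: v + h *: u) - f (x + h *: u).
have dg (h : R) : is_derive h (1 : R) g ('D_u f (x + t *: v + h *: u) - 'D_u f (x + h *: u)).
  by apply: is_deriveB; apply: is_derive_line.
have [|s' s'P gE] := MVT s0 (fun h _ => dg h).
  apply: derivable_within_continuous => h _; by have [] := dg h.
pose k (h : R) := 'D_u f (x + s' *: u + h *: v).
have dk (h : R) : is_derive h (1 : R) k ('D_v ('D_u f) (x + s' *: u + h *: v)).
  exact: is_derive_line.
have [|t' t'P kE] := MVT t0 (fun h _ => dk h).
  apply: derivable_within_continuous => h _; by have [] := dk h.
exists s', t'; split; [by rewrite in_itv in s'P|by rewrite in_itv in t'P|].
move: gE kE; rewrite /g /k !scale0r !addr0 !subr0 => gE kE.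
rewrite [x + t *: v + s *: u]addrAC in gE.
rewrite [x + t *: v + s' *: u]addrAC in gE.
have -> : f (x + s *: u + t *: v) - f (x + s *: u) - f (x + t *: v) + f x =
  f (x + s *: u + t *: v) - f (x + s *: u) - (f (x + t *: v) - f x) by ring.
by rewrite gE kE; ring.
Qed.

(** Schwarz's theorem. The second difference over the parallelogram with sides [d *: u] and [d *: v]
    is symmetric in [u] and [v], and equals [d * d] times either mixed derivative, each taken at
    some point near [x]. Continuity at [x] puts the common value within [e / 2] of both mixed
    derivatives at [x]. *)
Lemma derive_swap (R : realType) (V : normedModType R) (f : V -> R) (x u v : V) :
  (forall y, derivable f y u) -> (forall y, derivable f y v) ->
  (forall y, derivable ('D_u f) y v) -> (forall y, derivable ('D_v f) y u) ->
  {for x, continuous ('D_v ('D_u f))} -> {for x, continuous ('D_u ('D_v f))} ->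
  'D_v ('D_u f) x = 'D_u ('D_v f) x.
Proof.
move=> du dv duv dvu cuv cvu; apply/eqP; rewrite -subr_eq0 -normr_le0.
apply/ler_addgt0Pl => e e0; rewrite addr0.
have e2 : 0 < e / 2 by rewrite divr_gt0.
have /cvgrPdist_lt /(_ _ e2) /nbhs_ballP [r1 /= r10 H1] := cuv.
have /cvgrPdist_lt /(_ _ e2) /nbhs_ballP [r2 /= r20 H2] := cvu.
(* The summand 1 keeps [N] positive when [u = v = 0] and makes the bound in [near_x] strict: a
   displacement with parameters below [d] has norm at most [d * (|u| + |v|) < d * N]. *)
pose N := `|u| + `|v| + 1.
have N0 : 0 < N by rewrite /N ltr_wpDl // addr_ge0.
pose d := Num.min r1 r2 / N.
have d0 : 0 < d by rewrite divr_gt0 // lt_min r10 r20.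
have near_x (s t : R) : 0 < s < d -> 0 < t < d ->
    `|x - (x + s *: u + t *: v)| < Num.min r1 r2.
  move=> /andP[s0 sd] /andP[t0 td].
  rewrite -addrA opprD addNKr normrN (le_lt_trans (ler_normD _ _)) //.
  rewrite !normrZ !gtr0_norm // (@le_lt_trans _ _ (d * (`|u| + `|v|))) //.
    by rewrite mulrDr lerD // ler_wpM2r // ltW.
  have -> : Num.min r1 r2 = d * N by rewrite /d divfK // gt_eqF.
  by rewrite ltr_pM2l // ltrDl.
have [s1 [t1 [hs1 ht1 E1]]] := second_difference_MVT x du duv d0 d0.
have [t2 [s2 [ht2 hs2 E2]]] := second_difference_MVT x dv dvu d0 d0.
have B1 : ball x r1 (x + s1 *: u + t1 *: v).
  by rewrite -ball_normE /ball_ /=; have := near_x _ _ hs1 ht1; rewrite lt_min => /andP[].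
have B2 : ball x r2 (x + t2 *: v + s2 *: u).
  rewrite -ball_normE /ball_ /= addrAC.
  by have := near_x _ _ hs2 ht2; rewrite lt_min => /andP[].
have {}H1 := H1 _ B1; have {}H2 := H2 _ B2; move: H1 H2 => /= H1 H2.
(* [E1] and [E2] evaluate the same second difference, so the factor [d * d] cancels. *)
have EE : 'D_v ('D_u f) (x + s1 *: u + t1 *: v) = 'D_u ('D_v f) (x + t2 *: v + s2 *: u).
  have /mulIf cancel_dd : d * d != 0 by rewrite mulf_neq0 // gt_eqF.
  apply: cancel_dd; rewrite /= -E1 -E2.
  by rewrite [x + d *: v + d *: u]addrAC; ring.
by rewrite EE in H1; exact: normrB_le_half H1 H2.
Qed.

(** * Smooth functions, their derivatives and their matrix entries *)

Lemma Ck_on_cst (R : realType) (V W : normedModType R) (k : nat) (O : set V) (c : W) :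
  Ck_on k O (fun _ => c).
Proof.
elim: k c => [|k IH] c /=; split => //; try by move=> x _; exact: cvg_cst.
move=> v; split; first by move=> x _; exact: derivable_cst.
have -> : 'D_v (fun _ : V => c) = fun _ => 0 by apply/funext => x; exact: derive_cst.
exact: IH.
Qed.

Lemma smooth_derive (R : realType) (V W : normedModType R) (f : V -> W) (v : V) :
  smooth_on setT f -> smooth_on setT ('D_v f).
Proof. by move=> sf k; have [_ /(_ v)[]] := sf k.+1. Qed.

Lemma smooth_derivable (R : realType) (V W : normedModType R) (f : V -> W) (x v : V) :
  smooth_on setT f -> derivable f x v.
Proof. by move=> sf; have [_ /(_ v)[/(_ x I)]] := sf 1%N. Qed.

Lemma smooth_continuous (R : realType) (V W : normedModType R) (f : V -> W) (x : V) :
  smooth_on setT f -> {for x, continuous f}.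
Proof. by move=> sf; have [/(_ x I)] := sf 0%N. Qed.

Lemma derive_entry (R : realType) (V : normedModType R) (m n : nat)
    (M : V -> 'M[R]_(m, n)) (v : V) (i : 'I_m) (j : 'I_n) (x : V) :
  derivable M x v -> 'D_v (fun y => M y i j) x = 'D_v M x i j.
Proof. by move=> dM; rewrite derive_mx // mxE. Qed.

Lemma smooth_entry (R : realType) (V : normedModType R) (m n : nat)
    (M : V -> 'M[R]_(m, n)) (i : 'I_m) (j : 'I_n) :
  smooth_on setT M -> smooth_on setT (fun y => M y i j).
Proof.
move=> sM k; elim: k M sM => [|k IH] M sM /=; split=> //.
- move=> x _; apply: (@continuous_comp _ _ _ M (fun N : 'M[R]_(m, n) => N i j)).
    exact: smooth_continuous.
  exact: coord_continuous.
- move=> x _; apply: (@continuous_comp _ _ _ M (fun N : 'M[R]_(m, n) => N i j)).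
    exact: smooth_continuous.
  exact: coord_continuous.
- move=> v; split=> [x _|].
    by apply/(derivable_mxP M x v).1/smooth_derivable.
  have -> : 'D_v (fun y => M y i j) = fun y => 'D_v M y i j.
    by apply/funext => x; apply/derive_entry/smooth_derivable.
  exact/IH/smooth_derive.
Qed.

Lemma smooth_derive_swap (R : realType) (V : normedModType R) (f : V -> R) (u v : V) :
  smooth_on setT f -> 'D_v ('D_u f) = 'D_u ('D_v f).
Proof.
move=> sf; apply/funext => x.
by apply: derive_swap => [y|y|y|y||];
  (apply: smooth_derivable || apply: smooth_continuous); do ?apply: smooth_derive.
Qed.

Lemma derive_sum_fct (R : realType) (V : normedModType R) (n : nat)
    (f : 'I_n -> V -> R) (v : V) (x : V) :
  (forall i, smooth_on setT (f i)) ->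
  'D_v (fun y => \sum_(i < n) f i y) x = \sum_(i < n) 'D_v (f i) x.
Proof.
move=> sf; rewrite -derive_sum => [|i]; last exact: smooth_derivable.
by congr ('D_v _ x); apply/funext => y; rewrite fct_sumE.
Qed.

Lemma smooth_iter_dx (R : realType) (d k : nat) (W : normedModType R) (j : 'I_d)
    (f : R * 'rV[R]_d -> W) :
  smooth_on setT f -> smooth_on setT (iter k (dx j) f).
Proof. by move=> sf; elim: k => //= k; exact: smooth_derive. Qed.

Lemma iter_dx_entry (R : realType) (d k m n : nat) (j : 'I_d)
    (U : R * 'rV[R]_d -> 'M[R]_(m, n)) (p : 'I_m) (q : 'I_n) :
  smooth_on setT U ->
  iter k (dx j) (fun y => U y p q) = fun y => iter k (dx j) U y p q.
Proof.
move=> sU; elim: k => //= k ->; apply/funext => y.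
by apply/derive_entry/smooth_derivable/smooth_iter_dx.
Qed.

Lemma dmulti_entry (R : realType) (d m k n : nat) (alpha : mindex d m)
    (U : R * 'rV[R]_d -> 'M[R]_(k, n)) (p : 'I_k) (q : 'I_n) :
  smooth_on setT U ->
  dmulti alpha (fun y => U y p q) = fun y => dmulti alpha U y p q.
Proof.
move=> sU; rewrite /dmulti.
(* Smoothness is carried through the induction because each further differentiation commutes with
   taking an entry only for a differentiable function. *)
suff [_] : smooth_on setT (foldr (fun j g => iter (alpha j) (dx j) g) U (enum 'I_d)) /\
  foldr (fun j g => iter (alpha j) (dx j) g) (fun y => U y p q) (enum 'I_d) =
  (fun y => foldr (fun j g => iter (alpha j) (dx j) g) U (enum 'I_d) y p q) by [].
elim: (enum 'I_d) => //= j s [sV ->].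
by split; [exact: smooth_iter_dx | exact: iter_dx_entry].
Qed.

(** * Multi-indices of the system and sums over them *)

(** [inord] sends an entry above [m] to 0, whence the bounds on [b] in the lemmas that follow. *)
Definition mk_mindex (d m : nat) (b : 'I_d -> nat) : mindex d m :=
  [ffun j => inord (b j)].

Lemma mk_mindexE (d m : nat) (b : 'I_d -> nat) (j : 'I_d) :
  (b j <= m)%N -> mk_mindex m b j = b j :> nat.
Proof. by move=> bm; rewrite ffunE inordK. Qed.

Lemma mindex_isE (d m : nat) (alpha : mindex d m) (b : 'I_d -> nat) :
  (forall j, (b j <= m)%N) -> mindex_is alpha b = (alpha == mk_mindex m b).
Proof.
move=> bm; apply/forallP/eqP => [E | -> j]; last by rewrite mk_mindexE.
by apply/ffunP => j; apply/val_inj; rewrite /= mk_mindexE //; apply/eqP.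
Qed.

(** By linearity of [G alpha], every term with [alpha] different from [b] vanishes. Keeping [G]
    abstract covers both the scalar factors of the symbol and the product with a derivative of
    [U]. *)
Lemma sum_mindex_is (R : realType) (d m : nat) (V W : lmodType R)
    (P : pred (mindex d m)) (b : 'I_d -> nat) (G : mindex d m -> {linear V -> W})
    (X : V) :
  (forall j, (b j <= m)%N) ->
  \sum_(alpha | P alpha) G alpha ((mindex_is alpha b)%:R *: X) =
  if P (mk_mindex m b) then G (mk_mindex m b) X else 0.
Proof.
move=> bm; rewrite big_mkcond (bigD1 (mk_mindex m b)) //= big1 ?addr0.
  by rewrite mindex_isE // eqxx scale1r.
by move=> alpha /negPf ab; rewrite mindex_isE // ab scale0r linear0 if_same.
Qed.

(** The second index is written [lift ord0 ord0], the form that [big_ord_recl] and [enum_ordSl]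
    produce. *)
Lemma ord2_ind (P : 'I_2 -> Prop) : P ord0 -> P (lift ord0 ord0) -> forall i, P i.
Proof.
move=> P0 P1 i; case: (unliftP ord0 i) => [j|] -> //.
by rewrite (ord1 j).
Qed.

Lemma morder_mk (d m : nat) (b : 'I_d -> nat) :
  (forall j, (b j <= m)%N) -> morder (mk_mindex m b) = (\sum_j b j)%N.
Proof. by move=> bm; apply: eq_bigr => j _; rewrite mk_mindexE. Qed.

Lemma dmulti_mk2 (R : realType) (m : nat) (W : normedModType R) (b : 'I_2 -> nat)
    (f : R * 'rV[R]_2 -> W) :
  (forall j, (b j <= m)%N) ->
  dmulti (mk_mindex m b) f =
  iter (b ord0) (dx ord0) (iter (b (lift ord0 ord0)) (dx (lift ord0 ord0)) f).
Proof. by move=> bm; rewrite /dmulti !enum_ordSl enum_ord0 /= !mk_mindexE. Qed.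

(* The multi-indices e_j, 2 e_j, e_i + e_j and e_i + 2 e_j. *)
Definition mi1 (j : 'I_2) := mk_mindex 3 (fun l : 'I_2 => (l == j) : nat).
Definition mi2 (j : 'I_2) := mk_mindex 3 (fun l : 'I_2 => 2 * (l == j))%N.
Definition mi11 (i j : 'I_2) := mk_mindex 3 (fun l : 'I_2 => (l == i) + (l == j))%N.
Definition mi12 (i j : 'I_2) := mk_mindex 3 (fun l : 'I_2 => (l == i) + 2 * (l == j))%N.

Lemma morder_mi1 (j : 'I_2) : morder (mi1 j) = 1%N.
Proof.
rewrite morder_mk; last by move=> l; case: eqP.
by elim/ord2_ind: j; rewrite !big_ord_recl big_ord0.
Qed.

Lemma morder_mi2 (j : 'I_2) : morder (mi2 j) = 2%N.
Proof.
rewrite morder_mk; last by move=> l; case: eqP.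
by elim/ord2_ind: j; rewrite !big_ord_recl big_ord0.
Qed.

Lemma morder_mi11 (i j : 'I_2) : morder (mi11 i j) = 2%N.
Proof.
rewrite morder_mk; last by move=> l; do 2![case: eqP].
by elim/ord2_ind: i; elim/ord2_ind: j; rewrite !big_ord_recl big_ord0.
Qed.

Lemma morder_mi12 (i j : 'I_2) : morder (mi12 i j) = 3%N.
Proof.
rewrite morder_mk; last by move=> l; do 2![case: eqP].
by elim/ord2_ind: i; elim/ord2_ind: j; rewrite !big_ord_recl big_ord0.
Qed.

(** One expansion for three uses: [Q] selects odd orders for A, even orders for B, and all orders up
    to 3 for the differential operator. The multiplicities [*+ Q k] discard the groups of terms of
    an excluded order [k]. Pairs [(i, j)] giving the same multi-index stay separate summands, as in
    the equations. *)
Lemma sum_nsk_coef (R : realType) (rhob pb kb nub lamb : R) (ub : 'rV[R]_2)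
    (W : lmodType R) (Q : pred nat) (G : mindex 2 3 -> {linear 'M[R]_3 -> W}) :
  \sum_(alpha : mindex 2 3 | Q (morder alpha))
    G alpha (nsk_coef rhob pb kb nub lamb ub alpha) =
  (\sum_j G (mi1 j) ((ub 0 j)%:M + rhob *: delta_mx 0 (lift 0 j)
                       + (pb / rhob) *: delta_mx (lift 0 j) 0)) *+ Q 1%N
  - (\sum_j G (mi2 j) ((nub / rhob) *:
       \sum_(i < 2) delta_mx (lift 0 i) (lift 0 i))) *+ Q 2%N
  - (\sum_i \sum_j G (mi11 i j) (((nub + lamb) / rhob) *:
       delta_mx (lift 0 i) (lift 0 j))) *+ Q 2%N
  - (\sum_i \sum_j G (mi12 i j) (kb *: delta_mx (lift 0 i) 0)) *+ Q 3%N.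
Proof.
have pull (b : 'I_2 -> nat) X : (forall j, (b j <= 3)%N) ->
    \sum_(alpha | Q (morder alpha)) G alpha ((mindex_is alpha b)%:R *: X) =
    G (mk_mindex 3 b) X *+ Q (morder (mk_mindex 3 b)).
  by move=> bm; rewrite sum_mindex_is // -mulrb.
(* The four groups are separated by linearity; in each, the sum over [alpha] is moved innermost,
   where [pull] collapses it. *)
rewrite /nsk_coef; under eq_bigr do rewrite !linearB /=.
rewrite !sumrB; congr (_ - _ - _ - _); under [LHS]eq_bigr do rewrite linear_sum /=;
  rewrite exchange_big /= -sumrMnl; apply: eq_bigr => i _.
- rewrite pull; last by move=> l; case: eqP.
  by rewrite morder_mi1.
- rewrite pull; last by move=> l; case: eqP.
  by rewrite morder_mi2.
- under [LHS]eq_bigr do rewrite linear_sum /=.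
  rewrite exchange_big /= -sumrMnl; apply: eq_bigr => j _.
  rewrite pull; last by move=> l; do 2![case: eqP].
  by rewrite morder_mi11.
- under [LHS]eq_bigr do rewrite linear_sum /=.
  rewrite exchange_big /= -sumrMnl; apply: eq_bigr => j _.
  rewrite pull; last by move=> l; do 2![case: eqP].
  by rewrite morder_mi12.
Qed.

(** * Derivatives and monomials attached to these multi-indices *)

Lemma dmulti_mi1 (R : realType) (W : normedModType R) (j : 'I_2) (f : R * 'rV[R]_2 -> W) :
  dmulti (mi1 j) f = dx j f.
Proof.
by rewrite dmulti_mk2; [elim/ord2_ind: j | move=> l; case: eqP].
Qed.

Lemma dmulti_mi2 (R : realType) (W : normedModType R) (j : 'I_2) (f : R * 'rV[R]_2 -> W) :
  dmulti (mi2 j) f = dx j (dx j f).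
Proof.
by rewrite dmulti_mk2; [elim/ord2_ind: j | move=> l; case: eqP].
Qed.

(** [dmulti] applies the derivative in the first coordinate last, so only the case of [i] second and
    [j] first calls for exchanging derivatives. *)
Lemma dmulti_mi11 (R : realType) (i j : 'I_2) (f : R * 'rV[R]_2 -> R) :
  smooth_on setT f -> dmulti (mi11 i j) f = dx i (dx j f).
Proof.
move=> sf; rewrite dmulti_mk2; last by move=> l; do 2![case: eqP].
elim/ord2_ind: i; elim/ord2_ind: j; rewrite /=;
  [reflexivity|reflexivity|exact: smooth_derive_swap|reflexivity].
Qed.

Lemma dmulti_mi12 (R : realType) (i j : 'I_2) (f : R * 'rV[R]_2 -> R) :
  smooth_on setT f -> dmulti (mi12 i j) f = dx i (dx j (dx j f)).
Proof.
move=> sf; rewrite dmulti_mk2; last by move=> l; do 2![case: eqP].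
elim/ord2_ind: i; elim/ord2_ind: j; rewrite /=; [reflexivity|reflexivity| |reflexivity].
(* With indices 0 and 1, the case left is [i = 1], [j = 0]: two exchanges lead from the order 0, 0,
   1 through 0, 1, 0 to 1, 0, 0. *)
pose e k : R * 'rV[R]_2 := (0, delta_mx 0 k).
exact: (etrans (congr1 (dx ord0)
  (smooth_derive_swap (e (lift ord0 ord0)) (e ord0) sf))
  (smooth_derive_swap (e (lift ord0 ord0)) (e ord0) (smooth_derive (e ord0) sf))).
Qed.

Lemma monom_mk (R : realType) (d m : nat) (x : 'rV[R]_d) (b : 'I_d -> nat) :
  (forall j, (b j <= m)%N) ->
  monom x (mk_mindex m b) = \prod_(j < d) x 0 j ^+ b j.
Proof. by move=> bm; apply: eq_bigr => j _; rewrite mk_mindexE. Qed.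

Lemma monom_mi1 (R : realType) (x : 'rV[R]_2) (j : 'I_2) : monom x (mi1 j) = x 0 j.
Proof.
rewrite monom_mk; last by move=> l; case: eqP.
by elim/ord2_ind: j; rewrite !big_ord_recl big_ord0 /= expr0 expr1 ?mulr1 ?mul1r.
Qed.

Lemma monom_mi2 (R : realType) (x : 'rV[R]_2) (j : 'I_2) :
  monom x (mi2 j) = x 0 j ^+ 2.
Proof.
rewrite monom_mk; last by move=> l; case: eqP.
by elim/ord2_ind: j; rewrite !big_ord_recl big_ord0 /= ?muln0 ?muln1 expr0 ?mulr1 ?mul1r.
Qed.

Lemma monom_mi11 (R : realType) (x : 'rV[R]_2) (i j : 'I_2) :
  monom x (mi11 i j) = x 0 i * x 0 j.
Proof.
rewrite monom_mk; last by move=> l; do 2![case: eqP].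
by elim/ord2_ind: i; elim/ord2_ind: j; rewrite !big_ord_recl big_ord0 /=; ring.
Qed.

Lemma monom_mi12 (R : realType) (x : 'rV[R]_2) (i j : 'I_2) :
  monom x (mi12 i j) = x 0 i * x 0 j ^+ 2.
Proof.
rewrite monom_mk; last by move=> l; do 2![case: eqP].
by elim/ord2_ind: i; elim/ord2_ind: j; rewrite !big_ord_recl big_ord0 /=; ring.
Qed.

(** * Smoothness of affine functions of |xi|^2 *)

Lemma is_derive_coord (R : realType) (d : nat) (j : 'I_d) (x v : 'rV[R]_d) :
  is_derive x v (fun y : 'rV[R]_d => y 0 j) (v 0 j).
Proof.
have idd : derivable (fun y : 'rV[R]_d => y) x v by exact: derivable_id.
split; first exact: ((derivable_mxP _ _ _).1 idd).
by rewrite derive_entry // derive_id.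
Qed.

Lemma is_derive_linear_form (R : realType) (d : nat) (c x v : 'rV[R]_d) :
  is_derive x v (fun y : 'rV[R]_d => \sum_j c 0 j * y 0 j) (\sum_j c 0 j * v 0 j).
Proof.
have -> : (fun y : 'rV[R]_d => \sum_j c 0 j * y 0 j) =
    \sum_j (c 0 j \*: (fun y : 'rV[R]_d => y 0 j)).
  by apply/funext => y; rewrite fct_sumE.
by apply: is_derive_sum => j; apply: is_deriveZ; exact: is_derive_coord.
Qed.

(** The derivative is written as a linear form with coefficient vector [2 *: v], so that
    [is_derive_linear_form] can differentiate it once more. *)
Lemma is_derive_sum_sqr (R : realType) (d : nat) (x v : 'rV[R]_d) :
  is_derive x v (fun y : 'rV[R]_d => \sum_j y 0 j ^+ 2)
    (\sum_j (2 *: v) 0 j * x 0 j).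
Proof.
have -> : (fun y : 'rV[R]_d => \sum_j y 0 j ^+ 2) =
    \sum_j ((fun y : 'rV[R]_d => y 0 j) ^+ 2).
  by apply/funext => y; rewrite fct_sumE.
apply: is_derive_sum => j.
apply: is_derive_eq; first by apply: is_deriveX; exact: is_derive_coord.
by rewrite mxE expr1 /=; rewrite -[_ *: _]/(_ * _); ring.
Qed.

Lemma is_derive_scalel (R : realType) (V W : normedModType R) (g : V -> R) (C M : W)
    (x v : V) (dg : R) :
  is_derive x v g dg -> is_derive x v (fun y => C + g y *: M) (dg *: M).
Proof.
move=> [dgx <-].
have cv : (fun h : R => h^-1 *: (((fun y => C + g y *: M) \o shift x) (h *: v) -
    (C + g x *: M))) @ 0^' --> 'D_v g x *: M.
  have -> : (fun h : R => h^-1 *: (((fun y => C + g y *: M) \o shift x) (h *: v) -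
    (C + g x *: M))) = (fun h => (h^-1 *: ((g \o shift x) (h *: v) - g x)) *: M).
    by apply/funext => h /=; rewrite opprD addrACA subrr add0r -scalerBl scalerA.
  by apply: cvgZr_tmp; exact: dgx.
by split; [apply/cvg_ex; exists ('D_v g x *: M) | exact: cvg_lim].
Qed.

(** Smoothness is passed from an explicit formula [df] for the derivatives to [f], so that a
    concrete function is treated by successive differentiation. *)
Lemma smooth_on_is_derive (R : realType) (V W : normedModType R) (O : set V)
    (f : V -> W) (df : V -> V -> W) :
  continuous f -> (forall x v, is_derive x v f (df v x)) ->
  (forall v, smooth_on O (df v)) -> smooth_on O f.
Proof.
move=> cf dfE sdf; have dE v : 'D_v f = df v.
  by apply/funext => x; have [] := dfE x v.
case=> [|k]; split=> //; do ?[by move=> x _; exact: cf]; move=> v.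
by split=> [x _|]; [have [] := dfE x v | rewrite dE; exact: sdf].
Qed.

Lemma continuous_scalel_add (R : realType) (V W : normedModType R) (g : V -> R)
    (C M : W) : continuous g -> continuous (fun y => C + g y *: M).
Proof.
move=> cg x; apply: (@continuousD _ _ _ (fun=> C) (fun y => g y *: M)).
  exact: cvg_cst.
by apply: cvgZr_tmp; exact: cg.
Qed.

Lemma continuous_linear_form (R : realType) (d : nat) (c : 'rV[R]_d) :
  continuous (fun y : 'rV[R]_d => \sum_j c 0 j * y 0 j).
Proof.
apply: continuous_big => [|j _ x]; first exact: add_continuous.
apply: (@continuousM _ _ (fun=> c 0 j) (fun y : 'rV[R]_d => y 0 j)).
  exact: cst_continuous.
exact: coord_continuous.
Qed.

Lemma continuous_sum_sqr (R : realType) (d : nat) :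
  continuous (fun y : 'rV[R]_d => \sum_j y 0 j ^+ 2).
Proof.
apply: continuous_big => [|j _ x]; first exact: add_continuous.
by apply: (@continuousM _ _ (fun y : 'rV[R]_d => y 0 j) (fun y => y 0 j));
  exact: coord_continuous.
Qed.

(** Two differentiations lead from a quadratic function through a linear one to a constant, which is
    smooth. *)
Lemma smooth_sum_sqr (R : realType) (d : nat) (W : normedModType R)
    (O : set 'rV[R]_d) (C M : W) :
  smooth_on O (fun y : 'rV[R]_d => C + (\sum_j y 0 j ^+ 2) *: M).
Proof.
refine (@smooth_on_is_derive _ _ _ _ _
  (fun v y : 'rV[R]_d => (\sum_j (2 *: v) 0 j * y 0 j) *: M) _ _ _) => [|x v|v].
- exact/continuous_scalel_add/continuous_sum_sqr.
- by apply: is_derive_scalel; exact: is_derive_sum_sqr.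
have -> : (fun y : 'rV[R]_d => (\sum_j (2 *: v) 0 j * y 0 j) *: M) =
    (fun y => 0 + (\sum_j (2 *: v) 0 j * y 0 j) *: M).
  by apply/funext => y; rewrite add0r.
refine (@smooth_on_is_derive _ _ _ _ _
  (fun w _ : 'rV[R]_d => (\sum_j (2 *: v) 0 j * w 0 j) *: M) _ _ _) => [|x w|w].
- exact/continuous_scalel_add/continuous_linear_form.
- by apply: is_derive_scalel; exact: is_derive_linear_form.
by move=> k; exact: Ck_on_cst.
Qed.

(** * Euclidean norm and the unit direction *)

Lemma enorm_gt0 (R : realType) (d : nat) (xi : 'rV[R]_d) : xi != 0 -> 0 < enorm xi.
Proof.
move=> xi0; rewrite /enorm sqrtr_gt0 lt_neqAle sumr_ge0 ?andbT; last first.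
  by move=> j _; exact: sqr_ge0.
apply: contra xi0; rewrite eq_sym psumr_eq0; last by move=> j _; exact: sqr_ge0.
move=> /allP xi0; apply/eqP/rowP => j; rewrite mxE.
by have := xi0 j (mem_index_enum _); rewrite sqrf_eq0 => /eqP.
Qed.

Lemma enorm_sqr (R : realType) (d : nat) (xi : 'rV[R]_d) :
  enorm xi ^+ 2 = \sum_j xi 0 j ^+ 2.
Proof. by rewrite sqr_sqrtr // sumr_ge0 // => j _; exact: sqr_ge0. Qed.

Lemma enorm_unit (R : realType) (d : nat) (xi : 'rV[R]_d) : xi != 0 ->
  \sum_j ((enorm xi)^-1 *: xi) 0 j ^+ 2 = 1.
Proof.
move=> /enorm_gt0 e0; under eq_bigr do rewrite mxE exprMn.
by rewrite -mulr_sumr -enorm_sqr exprVn mulVf // expf_neq0 // gt_eqF.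
Qed.

(** * Closed forms of A and B *)

Section NskSymbol.
Variables (R : realType) (rhob pb kb nub lamb : R) (ub : 'rV[R]_2).
Local Notation L := (nsk_coef rhob pb kb nub lamb ub).

(** The third-order terms carry the factor -|xi|^2 w_i w_j^2, whose sign cancels the minus sign of
    the capillarity in [nsk_coef]; summing over [j] with |w| = 1 leaves k |xi|^2 w_i. *)
Lemma symbA_nsk (xi : 'rV[R]_2) : xi != 0 ->
  let w := (enorm xi)^-1 *: xi in
  let s := \sum_j ub 0 j * w 0 j in
  symbA L xi = \matrix_(p < 3, q < 3)
    match unlift ord0 p, unlift ord0 q with
    | None, None => s
    | None, Some j => rhob * w 0 j
    | Some i, None => (pb / rhob + kb * enorm xi ^+ 2) * w 0 i
    | Some i, Some j => s * (i == j)%:R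
    end.
Proof.
move=> xi0 w s; have w1 : w 0 ord0 ^+ 2 + w 0 (lift ord0 ord0) ^+ 2 = 1.
  by have := enorm_unit xi0; rewrite !big_ord_recl big_ord0 addr0.
pose c (alpha : mindex 2 3) : R := enorm xi ^+ (morder alpha).-1 *
  (-1) ^+ ((morder alpha).-1)./2 * monom w alpha.
pose G alpha : {linear 'M[R]_3 -> 'M[R]_3} := *:%R (c alpha).
have := sum_nsk_coef rhob pb kb nub lamb ub (fun n => (n <= 3)%N && odd n) G.
rewrite -/(symbA L xi) => ->.
rewrite /= !mulr1n !mulr0n !subr0 /c.
under eq_bigr do rewrite morder_mi1 monom_mi1 /= !expr0 !mul1r.
under [X in _ - X]eq_bigr => i _ do under eq_bigr => j _ do
  rewrite morder_mi12 monom_mi12 /= expr1 mulrN1.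
(* The relation |w| = 1 is oriented as a rewriting rule, and [w] is made opaque, so that [ring] can
   treat its entries as free variables. *)
have {}w1 : w 0 (lift ord0 ord0) ^+ 2 = 1 - w 0 ord0 ^+ 2 by rewrite -w1 addrC addKr.
clearbody w; apply/matrixP => p q; rewrite /s !big_ord_recl !big_ord0 !mxE.
by case: (unliftP ord0 p) => [i|] ->; case: (unliftP ord0 q) => [j|] ->;
  try elim/ord2_ind: i; try elim/ord2_ind: j; rewrite /= ?w1; ring.
Qed.

(** The sign -1 of the second-order symbol cancels the minus sign of the viscous terms. The sum of
    the [w 0 j ^+ 2] is left unevaluated; it equals 1 when [xi != 0]. *)
Lemma symbB_nsk (xi : 'rV[R]_2) :
  let w := (enorm xi)^-1 *: xi in
  symbB L xi = \matrix_(p < 3, q < 3)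
    match unlift ord0 p, unlift ord0 q with
    | Some i, Some j => enorm xi ^+ 2 *
        (nub / rhob * (\sum_j w 0 j ^+ 2) * (i == j)%:R
         + (nub + lamb) / rhob * (w 0 i * w 0 j))
    | _, _ => 0
    end.
Proof.
move=> w.
pose c (alpha : mindex 2 3) : R := enorm xi ^+ morder alpha *
  (-1) ^+ (morder alpha)./2 * monom w alpha.
pose G alpha : {linear 'M[R]_3 -> 'M[R]_3} := *:%R (c alpha).
have := sum_nsk_coef rhob pb kb nub lamb ub (fun n => (n <= 3)%N && ~~ odd n) G.
rewrite -/(symbB L xi) => ->.
rewrite /= !mulr1n !mulr0n !subr0 sub0r /c.
under eq_bigr do rewrite morder_mi2 monom_mi2 /= expr1 mulrN1.
under [X in _ - X]eq_bigr => i _ do under eq_bigr => j _ do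
  rewrite morder_mi11 monom_mi11 /= expr1 mulrN1.
clearbody w; apply/matrixP => p q; rewrite !big_ord_recl !big_ord0 !mxE.
by case: (unliftP ord0 p) => [i|] ->; case: (unliftP ord0 q) => [j|] ->;
  try elim/ord2_ind: i; try elim/ord2_ind: j; rewrite /= ?big_ord_recl ?big_ord0; ring.
Qed.

End NskSymbol.

(** * The symmetrizer and genuine coupling *)

Lemma quad_diag_mx (R : realType) (n : nat) (d : 'rV[R]_n) (v : 'cV[R]_n) :
  (v^T *m diag_mx d *m v) 0 0 = \sum_i d 0 i * v i 0 ^+ 2.
Proof.
rewrite -mulmxA mul_diag_mx mxE; apply: eq_bigr => i _.
by rewrite !mxE expr2 mulrCA.
Qed.

Lemma posdef_diag_mx (R : realType) (n : nat) (d : 'rV[R]_n) :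
  (forall i, 0 < d 0 i) -> posdefmx (diag_mx d).
Proof.
move=> d0; split=> [|v v0]; first exact: tr_diag_mx.
have dv i : 0 <= d 0 i * v i 0 ^+ 2 by rewrite mulr_ge0 ?sqr_ge0 // ltW.
rewrite quad_diag_mx lt_neqAle sumr_ge0 // andbT eq_sym.
apply: contra v0; rewrite psumr_eq0 // => /allP dv0; apply/eqP/colP => i.
have := dv0 i (mem_index_enum _).
by rewrite mulf_eq0 gt_eqF //= sqrf_eq0 mxE => /eqP.
Qed.

Section NskSymmetrizer.
Variables (R : realType) (rhob pb kb nub lamb : R) (ub : 'rV[R]_2).
Hypotheses (rhob_gt0 : 0 < rhob) (pb_gt0 : 0 < pb) (kb_gt0 : 0 < kb)
  (nub_gt0 : 0 < nub) (lamb_gt0 : 0 < lamb).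
Local Notation L := (nsk_coef rhob pb kb nub lamb ub).

(** Split as a constant matrix plus |xi|^2 times a constant matrix, the shape required by
    [smooth_sum_sqr]; [nsk_symmetrizerE] recovers the diagonal form. *)
Definition nsk_symmetrizer (xi : 'rV[R]_2) : 'M[R]_3 :=
  diag_mx (\row_p if unlift ord0 p is Some _ then 1 else pb / rhob / rhob)
  + (\sum_j xi 0 j ^+ 2) *: ((kb / rhob) *: delta_mx 0 0).

Lemma nsk_symmetrizerE (xi : 'rV[R]_2) :
  nsk_symmetrizer xi = diag_mx (\row_p
    if unlift ord0 p is Some _ then 1 else (pb / rhob + kb * enorm xi ^+ 2) / rhob).
Proof.
rewrite /nsk_symmetrizer -enorm_sqr; apply/matrixP => p q; rewrite !mxE.
by case: (unliftP ord0 p) => [i|] ->; case: (unliftP ord0 q) => [j|] ->;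
  rewrite /=; ring.
Qed.

(** Writing the form as a positive combination of squares serves twice: it shows that B is
    nonnegative, and that a vector in its kernel has zero velocity part. *)
Lemma quad_symbB (xi : 'rV[R]_2) (v : 'cV[R]_3) : xi != 0 ->
  let w := (enorm xi)^-1 *: xi in
  (v^T *m symbB L xi *m v) 0 0 = enorm xi ^+ 2 *
    (nub / rhob * \sum_(i < 2) v (lift 0 i) 0 ^+ 2
     + (nub + lamb) / rhob * (\sum_(i < 2) w 0 i * v (lift 0 i) 0) ^+ 2).
Proof.
move=> xi0 w; rewrite symbB_nsk enorm_unit // -/w; clearbody w.
rewrite !mxE !big_ord_recl !big_ord0 !mxE !big_ord_recl !big_ord0 !mxE /=.
rewrite !(unlift_none, liftK) /=.
by ring.
Qed.

Lemma nsk_symbol_symmetrizable : symbol_symmetrizable L.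
Proof.
exists nsk_symmetrizer; split; first exact: smooth_sum_sqr.
move=> xi xi0; have e0 := enorm_gt0 xi0; split.
- rewrite nsk_symmetrizerE; apply: posdef_diag_mx => p; rewrite mxE.
  by case: unlift => [i|] //; rewrite divr_gt0 // addr_gt0 ?divr_gt0 // mulr_gt0 ?exprn_gt0.
- rewrite nsk_symmetrizerE mul_diag_mx symbA_nsk //; apply/matrixP => p q.
  rewrite !mxE; case: (unlift _ p) => [i|]; case: (unlift _ q) => [j|] //=.
  + by rewrite eq_sym.
  + by field; rewrite gt_eqF.
  + by field; rewrite gt_eqF.
(* S is the identity on the velocity rows, and the density row of B is zero. *)
have -> : nsk_symmetrizer xi *m symbB L xi = symbB L xi.
  rewrite nsk_symmetrizerE mul_diag_mx symbB_nsk; apply/matrixP => p q.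
  by rewrite !mxE; case: unlift => [i|] /=; rewrite ?mul1r ?mulr0.
split=> [|v].
  rewrite symbB_nsk; apply/matrixP => p q; rewrite !mxE.
  case: (unlift _ p) => [i|]; case: (unlift _ q) => [j|] //=.
  by rewrite eq_sym; ring.
rewrite quad_symbB //; apply: mulr_ge0; first exact: sqr_ge0.
apply: addr_ge0; apply: mulr_ge0.
- by rewrite divr_ge0 ?ltW.
- by apply: sumr_ge0 => i _; exact: sqr_ge0.
- by rewrite divr_ge0 ?addr_ge0 ?ltW.
- exact: sqr_ge0.
Qed.

Lemma nsk_genuinely_coupled : genuinely_coupled L.
Proof.
move=> xi xi0 mu psi Bpsi; apply: contra_neq => Apsi.
have e0 := enorm_gt0 xi0; have w1 := enorm_unit xi0.
have e20 : 0 < enorm xi ^+ 2 by rewrite exprn_gt0.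
(* Since B psi = 0, the quadratic form vanishes at [psi]; both of its summands are nonnegative, and
   the shear term alone forces the velocity part to be zero. *)
have psi_u (i : 'I_2) : psi (lift 0 i) 0 = 0.
  have := quad_symbB psi xi0; rewrite -mulmxA Bpsi mulmx0 mxE => /esym/eqP.
  rewrite mulf_eq0 gt_eqF //=.
  have c1 : 0 < nub / rhob by rewrite divr_gt0.
  have c2 : 0 <= (nub + lamb) / rhob by rewrite divr_ge0 ?addr_ge0 ?ltW.
  rewrite paddr_eq0; last 2 first.
  - apply: mulr_ge0; first exact: ltW.
    by apply: sumr_ge0 => j _; exact: sqr_ge0.
  - by rewrite mulr_ge0 ?sqr_ge0.
  move=> /andP[+ _]; rewrite mulf_eq0 gt_eqF //= psumr_eq0 => [/allP psi0|j _]; last first.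
    exact: sqr_ge0.
  by have := psi0 i (mem_index_enum _); rewrite sqrf_eq0 => /eqP.
have psi_rho : psi 0 0 = 0.
  (* In the velocity rows of (mu I + A) psi = 0, the terms with [mu] and with the velocity block of
     A vanish by [psi_u]. *)
  have row_u (i : 'I_2) : (pb / rhob + kb * enorm xi ^+ 2) *
      ((enorm xi)^-1 *: xi) 0 i * psi 0 0 = 0.
    have /colP /(_ (lift 0 i)) := Apsi.
    rewrite mulmxDl mul_scalar_mx symbA_nsk // [in RHS]mxE => E.
    rewrite -[RHS]E; set A := \matrix_(_, _) _.
    rewrite [RHS]mxE [X in _ = X + _]mxE psi_u mulr0 add0r [RHS]mxE big_ord_recl big1 => [|j _]; last first.
      by rewrite psi_u mulr0.
    by rewrite addr0 [A _ _]mxE liftK unlift_none.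
  have c0 : pb / rhob + kb * enorm xi ^+ 2 != 0.
    by rewrite gt_eqF // addr_gt0 ?divr_gt0 // mulr_gt0.
  (* Multiplying by 1 = |w|^2 avoids selecting a nonzero component of w. *)
  rewrite -[psi 0 0]mul1r -w1 mulr_suml big1 // => i _.
  have /eqP := row_u i; rewrite -mulrA mulf_eq0 (negPf c0) /= => /eqP wpsi.
  by rewrite expr2 -mulrA wpsi mulr0.
apply/colP => p; rewrite [RHS]mxE.
by case: (unliftP ord0 p) => [i|] ->.
Qed.

End NskSymmetrizer.

(** * Equivalence of the equations with the coefficient form *)

(* The a's stand for the derivatives of U, so that the rows are computed by pure algebra. *)
Lemma nsk_sum_rows (R : realType) (rhob pb kb nub lamb : R) (ub : 'rV[R]_2)
    (a1 a2 : 'I_2 -> 'cV[R]_3) (a11 a12 : 'I_2 -> 'I_2 -> 'cV[R]_3) :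
  let T : 'cV[R]_3 :=
    \sum_j ((ub 0 j)%:M + rhob *: delta_mx 0 (lift 0 j)
              + (pb / rhob) *: delta_mx (lift 0 j) 0) *m a1 j
    - \sum_j ((nub / rhob) *: \sum_(i < 2) delta_mx (lift 0 i) (lift 0 i)) *m a2 j
    - \sum_i \sum_j (((nub + lamb) / rhob) *: delta_mx (lift 0 i) (lift 0 j)) *m a11 i j
    - \sum_i \sum_j (kb *: delta_mx (lift 0 i) 0) *m a12 i j in
  T 0 0 = \sum_j ub 0 j * a1 j 0 0 + rhob * \sum_j a1 j (lift 0 j) 0 /\
  forall i, T (lift 0 i) 0 = \sum_j ub 0 j * a1 j (lift 0 i) 0 + pb / rhob * a1 i 0 0
    - nub / rhob * \sum_j a2 j (lift 0 i) 0
    - (nub + lamb) / rhob * \sum_j a11 i j (lift 0 j) 0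
    - kb * \sum_j a12 i j 0 0.
Proof.
split=> [|i]; last elim/ord2_ind: i;
  rewrite !big_ord_recl !big_ord0 !mxE !big_ord_recl !big_ord0 !mxE /=;
  ring.
Qed.

Lemma dx_divg (R : realType) (d : nat) (i : 'I_d) (v : 'I_d -> R * 'rV[R]_d -> R) z :
  (forall j, smooth_on setT (v j)) ->
  dx i (divg v) z = \sum_j dx i (dx j (v j)) z.
Proof.
move=> sv; apply: (@derive_sum_fct _ _ _ (fun j => dx j (v j))) => j.
exact: smooth_derive.
Qed.

Lemma dx_lapl (R : realType) (d : nat) (i : 'I_d) (f : R * 'rV[R]_d -> R) z :
  smooth_on setT f -> dx i (lapl f) z = \sum_j dx i (dx j (dx j f)) z.
Proof.
move=> sf; apply: (@derive_sum_fct _ _ _ (fun j => dx j (dx j f))) => j.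
by do 2!apply: smooth_derive.
Qed.

(** The difference of the two sides is [r] times the divided expression. Here [r] is the density,
    [t] the time derivative, and [A], [P], [N], [D], [K] the advection, pressure, Laplacian,
    grad-div and capillarity terms. *)
Lemma momentum_div_iff (F : fieldType) (r t p n l k A P N D K : F) : r != 0 ->
  r * t + r * A + p * P = n * N + l * D + k * r * K <->
  t + (A + p / r * P - n / r * N - l / r * D - k * K) = 0.
Proof.
move=> r0; have E : r * t + r * A + p * P - (n * N + l * D + k * r * K) =
  r * (t + (A + p / r * P - n / r * N - l / r * D - k * K)) by field.
split=> [/eqP|H]; first by rewrite -subr_eq0 E mulf_eq0 (negPf r0) => /eqP.
by apply/eqP; rewrite -subr_eq0 E H mulr0.
Qed.

Lemma nsk_system_has_form (R : realType) (rhob pb kb nub lamb : R) (ub : 'rV[R]_2) :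
  0 < rhob ->
  system_has_form (nsk rhob pb kb nub lamb ub) (nsk_coef rhob pb kb nub lamb ub).
Proof.
move=> rhob_gt0 U sU z.
have sc p : smooth_on setT (fun y => U y p 0) by exact: smooth_entry.
(* The product of L^alpha with the derivative of [U] is linear in L^alpha, so the expansion of the
   coefficients applies. *)
pose G (alpha : mindex 2 3) : {linear 'M[R]_3 -> 'cV[R]_3} := mulmxr (dmulti alpha U z).
have := sum_nsk_coef rhob pb kb nub lamb ub (fun n => (n <= 3)%N) G.
rewrite /= !mulr1n => ->.
have w p alpha : dmulti alpha U z p 0 = dmulti alpha (fun y => U y p 0) z.
  by rewrite (dmulti_entry alpha p 0 sU).
have w1 p j : dmulti (mi1 j) U z p 0 = dx j (fun y => U y p 0) z.
  by rewrite w dmulti_mi1.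
have w2 p j : dmulti (mi2 j) U z p 0 = dx j (dx j (fun y => U y p 0)) z.
  by rewrite w dmulti_mi2.
have w11 p i j : dmulti (mi11 i j) U z p 0 = dx i (dx j (fun y => U y p 0)) z.
  by rewrite w (dmulti_mi11 i j (sc p)).
have w12 p i j : dmulti (mi12 i j) U z p 0 = dx i (dx j (dx j (fun y => U y p 0))) z.
  by rewrite w (dmulti_mi12 i j (sc p)).
have wt p : dt U z p 0 = dt (fun y => U y p 0) z.
  by symmetry; apply/derive_entry/smooth_derivable.
set T := (X in dt U z + X = 0).
have [T0 Tu] : T 0 0 = _ /\ forall i, T (lift 0 i) 0 = _ :=
  nsk_sum_rows rhob pb kb nub lamb ub (fun j => dmulti (mi1 j) U z)
  (fun j => dmulti (mi2 j) U z) (fun i j => dmulti (mi11 i j) U z)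
  (fun i j => dmulti (mi12 i j) U z).
(* The vector equation is split into its density row and its two velocity rows, to be matched with
   mass and momentum. *)
clearbody T; apply: (iff_trans (B := dt U z 0 0 + T 0 0 = 0 /\
  forall i : 'I_2, dt U z (lift 0 i) 0 + T (lift 0 i) 0 = 0)); last first.
  split=> [[e0 eu]|e]; last first.
    by split=> [|i]; [have /colP/(_ 0) := e | have /colP/(_ (lift 0 i)) := e];
      rewrite !mxE.
  apply/colP => p; rewrite [LHS]mxE [RHS]mxE.
  by case: (unliftP 0 p) => [i|] ->.
rewrite /nsk; rewrite T0 !wt.
under [X in _ <-> (_ + (X + _) = 0 /\ _)]eq_bigr do rewrite w1.
under [X in _ <-> (_ + (_ + _ * X) = 0 /\ _)]eq_bigr do rewrite w1.
have mom (i : 'I_2) : 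
  rhob * dt (fun y => U y (lift 0 i) 0) z
    + rhob * (\sum_(j < 2) ub 0 j * dx j (fun y => U y (lift 0 i) 0) z)
    + pb * dx i (fun y => U y 0 0) z
  = nub * lapl (fun y => U y (lift 0 i) 0) z
    + (nub + lamb) * dx i (divg (fun (j : 'I_2) y => U y (lift 0 j) 0)) z
    + kb * rhob * dx i (lapl (fun y => U y 0 0)) z <->
  dt U z (lift 0 i) 0 + T (lift 0 i) 0 = 0.
  rewrite wt Tu dx_divg // dx_lapl // w1.
  under [X in _ <-> _ + (X + _ - _ - _ - _) = 0]eq_bigr do rewrite w1.
  under [X in _ <-> _ + (_ - _ * X - _ - _) = 0]eq_bigr do rewrite w2.
  under [X in _ <-> _ + (_ - _ * X - _) = 0]eq_bigr do rewrite w11.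
  under [X in _ <-> _ + (_ - _ * X) = 0]eq_bigr do rewrite w12.
  by apply: momentum_div_iff; exact: lt0r_neq0.
rewrite addrA; split=> -[mass eu]; split=> // i; exact/mom/eu.
Qed.

Theorem proposition5p1 (R : realType) (rhob pb kb nub lamb : R) (ub : 'rV[R]_2)
    (rhob_gt0 : 0 < rhob) (pb_gt0 : 0 < pb) (kb_gt0 : 0 < kb)
    (nub_gt0 : 0 < nub) (lamb_gt0 : 0 < lamb) :
  let L := nsk_coef rhob pb kb nub lamb ub in
  [/\ system_has_form (nsk rhob pb kb nub lamb ub) L,
      symbol_symmetrizable L &
      genuinely_coupled L].
Proof.
move=> L; split.
- exact: nsk_system_has_form.
- exact: nsk_symbol_symmetrizable.
- exact: nsk_genuinely_coupled.
Qed.
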